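(* Let $Q$ be a finite-dimensional vector space, $f:Q\to Q$ a vector field and $L:Q\to\mathbb R$ a function, and let $a_{ij}$, $b_i>0$ ($1\le i,j\le s$) be Runge--Kutta coefficients with $\tilde a_{ij}=(b_ib_j-b_ja_{ji})/b_i$. Suppose $q_0,q_1,Q^i\in Q$ and $p_0,p_1,P^i\in Q^*$ satisfy $$q_1=q_0+\Delta t\sum_ib_if(Q^i),\qquad Q^i=q_0+\Delta t\sum_ja_{ij}f(Q^j),$$ $$p_1=p_0-\Delta t\sum_ib_i\big([Df(Q^i)]^*P^i+dL(Q^i)\big),\qquad P^i=p_0-\Delta t\sum_j\tilde a_{ij}\big([Df(Q^j)]^*P^j+dL(Q^j)\big),$$ and suppose $\delta q_0,\delta q_1,\delta Q^i$ satisfy the discrete variational equations $$\delta q_1=\delta q_0+\Delta t\sum_ib_iDf(Q^i)\delta Q^i,\qquad \delta Q^i=\delta q_0+\Delta t\sum_ja_{ij}Df(Q^j)\delta Q^j.$$ Then $$\langle p_1,\delta q_1\rangle=\langle p_0,\delta q_0\rangle-\Delta t\sum_ib_i\langle dL(Q^i),\delta Q^i\rangle.$$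
   Context: All maps are smooth; $\Delta t>0$ is the timestep; $\langle\cdot,\cdot\rangle$ is the pairing of $Q^*$ with $Q$, and $[Df(q)]^*:Q^*\to Q^*$ is the adjoint of the linearization $Df(q)$. The first system is the Galerkin Hamiltonian variational integrator (a symplectic partitioned Runge--Kutta method) applied to $H_L(q,p)=\langle p,f(q)\rangle+L(q)$. *)

(* Defs.v *)
From HB Require Import structures.
From mathcomp Require Import all_boot all_order all_algebra.
From mathcomp Require Import all_classical all_reals all_analysis.

Set Implicit Arguments.
Unset Strict Implicit.
Unset Printing Implicit Defensive.

Import Order.TTheory GRing.Theory Num.Theory.
Import numFieldNormedType.Exports.

Local Open Scope ring_scope.

(* Finite-dimensional real vector spaces. All norms on such a space are
   equivalent, so the norm carried by the structure only serves to give access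
   to differentiation; neither smoothness nor the differential depends on it. *)
#[short(type="finDimNormedModType")]
HB.structure Definition FinDimNormedModule (R : numFieldType) :=
  {V of NormedModule R V & Vector R V}.

HB.instance Definition _ (R : numFieldType) := Vector.on R^o.

Section Calculus.
Context {R : realType}.

(* On a finite-dimensional domain, continuity of x |-> 'd f x as a map into
   linear maps amounts to continuity of x |-> 'd f x v for every fixed v, so the
   following is the usual class C^n. *)
Fixpoint continuously_differentiable (n : nat) {V : finDimNormedModType R}
    {W : normedModType R} (f : V -> W) : Prop :=
  if n is n'.+1 then
    (forall x, differentiable f x) /\
    (forall v, continuously_differentiable n' (fun x => 'd f x v))
  else continuous f.

Definition smooth {V : finDimNormedModType R} {W : normedModType R}
    (f : V -> W) : Prop :=
  forall n, continuously_differentiable n f.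

Definition Diff {V W : finDimNormedModType R} (f : V -> W) (x : V) :
    'Hom(V, W) :=
  linfun ('d f x).

Lemma DiffE {V W : finDimNormedModType R} (f : V -> W) (x v : V) :
  Diff f x v = 'd f x v.
Proof. by rewrite lfunE. Qed.

End Calculus.

Section Duality.
Context {R : realType}.

Definition dual (V : vectType R) : vectType R := 'Hom(V, R^o).

Definition pairing {V : vectType R} (p : dual V) (v : V) : R :=
  (p : 'Hom(V, R^o)) v.

Definition adjoint {V W : vectType R} (A : 'Hom(V, W)) (p : dual W) : dual V :=
  ((p : 'Hom(W, R^o)) \o A)%VF.

End Duality.

Definition conjugate_coeff {R : fieldType} {s : nat}
    (a : 'I_s -> 'I_s -> R) (b : 'I_s -> R) (i j : 'I_s) : R :=
  (b i * b j - b j * a j i) / b i.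

(* Main.v *)
(** For any vectors k_i and covectors F_i, the two Runge-Kutta sweeps change the
    pairing by dt sum_i b_i (<P^i, k_i> - <F_i, dQ^i>), because the terms of
    order dt^2 cancel exactly when b_i a~_ij + b_j a_ji = b_i b_j. With
    k_i = Df(Q^i) dQ^i and F_i = Df(Q^i)^* P^i + dL(Q^i), the f-contributions
    cancel by duality and only - <dL(Q^i), dQ^i> is left. *)

Require Import Defs.
From mathcomp Require Import all_boot all_order all_algebra.
From mathcomp Require Import all_classical all_reals all_analysis.

Import Order.TTheory GRing.Theory Num.Theory.
Import numFieldNormedType.Exports.

Local Open Scope ring_scope.

(** The symplecticity condition for partitioned Runge-Kutta pairs: multiplying by [b i] clears the
    denominator of the conjugate coefficient. *)
Lemma conjugate_coeff_symplectic (K : fieldType) (s : nat)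
  (a : 'I_s -> 'I_s -> K) (b : 'I_s -> K) (i j : 'I_s) :
  b i != 0 -> b i * conjugate_coeff a b i j + b j * a j i = b i * b j.
Proof. by move=> bi0; rewrite /conjugate_coeff mulrC divfK// subrK. Qed.

Lemma lfun_add_scaled_sum (K : fieldType) (V W : vectType K) (s : nat)
  (p : 'Hom(V, W)) (v : V) (h : K) (c : 'I_s -> K) (k : 'I_s -> V) :
  p (v + h *: \sum_i c i *: k i) = p v + h *: \sum_i c i *: p (k i).
Proof.
rewrite linearD linearZ linear_sum; congr (_ + _ *: _).
by apply: eq_bigr => i _; rewrite linearZ.
Qed.

Lemma sub_scaled_sum_lfun (K : fieldType) (V W : vectType K) (s : nat)
  (p : 'Hom(V, W)) (h : K) (c : 'I_s -> K) (F : 'I_s -> 'Hom(V, W)) (v : V) :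
  (p - h *: \sum_i c i *: F i) v = p v - h *: \sum_i c i *: F i v.
Proof.
rewrite add_lfunE opp_lfunE scale_lfunE sum_lfunE; congr (_ - _ *: _).
by apply: eq_bigr => i _; rewrite scale_lfunE.
Qed.

(** Both sides are polynomials in [h] once [P] and [u] are eliminated, with [F] and [k] held fixed;
    they are compared degree by degree. The tableau [a'] enters only through the relation with [a]
    and [b]. *)
Lemma symplectic_pairing_increment (K : fieldType) (V W : vectType K) (s : nat)
  (a a' : 'I_s -> 'I_s -> K) (b : 'I_s -> K) (h : K)
  (p : 'Hom(V, W)) (F P : 'I_s -> 'Hom(V, W)) (v : V) (k u : 'I_s -> V) :
  (forall i j, b i * a' i j + b j * a j i = b i * b j) ->
  (forall i, P i = p - h *: \sum_(j < s) a' i j *: F j) ->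
  (forall i, u i = v + h *: \sum_(j < s) a i j *: k j) ->
  (p - h *: \sum_(i < s) b i *: F i) (v + h *: \sum_(i < s) b i *: k i) =
    p v + h *: \sum_(i < s) b i *: (P i (k i) - F i (u i)).
Proof.
move=> symp PE uE.
(* Swapping the sums in the last term turns [a i j *: F i (k j)] into [a j i *: F j (k i)], so
   [symp] applies for each pair of indices. *)
have second_order : \sum_i \sum_j (b i * b j) *: F j (k i) =
    \sum_i b i *: \sum_j a' i j *: F j (k i) +
    \sum_i b i *: \sum_j a i j *: F i (k j).
  under [X in _ + X]eq_bigr do rewrite scaler_sumr.
  rewrite [X in _ + X]exchange_big -big_split; apply: eq_bigr => i _ /=.
  rewrite scaler_sumr -big_split; apply: eq_bigr => j _ /=.
  by rewrite !scalerA -scalerDl symp.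
(* The corrections from [P i] and [u i] both enter with sign minus, hence add up to
   [second_order]. *)
have incrE : \sum_i b i *: (P i (k i) - F i (u i)) =
    \sum_i b i *: p (k i) - \sum_i b i *: F i v -
    h *: \sum_i \sum_j (b i * b j) *: F j (k i).
  rewrite second_order scalerDr !scaler_sumr -big_split -!sumrB.
  apply: eq_bigr => i _ /=.
  rewrite PE uE sub_scaled_sum_lfun lfun_add_scaled_sum.
  rewrite !(scalerA h) ![h * b i]mulrC -!scalerA -!scalerBr -scalerDr -scalerBr.
  by rewrite !opprD addrACA addrA.
rewrite incrE sub_scaled_sum_lfun lfun_add_scaled_sum.
under [X in _ - _ *: X]eq_bigr do rewrite lfun_add_scaled_sum scalerDr.
rewrite big_split /= -addrA -!scalerBr opprD addrA; congr (_ + h *: (_ - _)).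
(* Only the terms of degree two in [h] remain; after the exchange the outer index is that of [F] on
   both sides. *)
rewrite exchange_big scaler_sumr; apply: eq_bigr => i _ /=.
rewrite scalerA mulrC -scalerA scaler_sumr; congr (h *: _).
by apply: eq_bigr => j _; rewrite scalerA mulrC.
Qed.

Theorem proposition3p1 (R : realType) (Q : finDimNormedModType R)
  (f : Q -> Q) (L : Q -> R^o) (f_smooth : smooth f) (L_smooth : smooth L)
  (dt : R) (dt_gt0 : 0 < dt)
  (s : nat) (a : 'I_s -> 'I_s -> R) (b : 'I_s -> R)
  (b_gt0 : forall i, 0 < b i)
  (q0 q1 : Q) (Qs : 'I_s -> Q) (p0 p1 : dual Q) (Ps : 'I_s -> dual Q)
  (q1E : q1 = q0 + dt *: \sum_(i < s) b i *: f (Qs i))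
  (QsE : forall i, Qs i = q0 + dt *: \sum_(j < s) a i j *: f (Qs j))
  (p1E : p1 = p0 - dt *: \sum_(i < s)
    b i *: (adjoint (Diff f (Qs i)) (Ps i) + Diff L (Qs i)))
  (PsE : forall i, Ps i = p0 - dt *: \sum_(j < s)
    conjugate_coeff a b i j *:
      (adjoint (Diff f (Qs j)) (Ps j) + Diff L (Qs j)))
  (dq0 dq1 : Q) (dQs : 'I_s -> Q)
  (dq1E : dq1 = dq0 + dt *: \sum_(i < s) b i *: Diff f (Qs i) (dQs i))
  (dQsE : forall i,
    dQs i = dq0 + dt *: \sum_(j < s) a i j *: Diff f (Qs j) (dQs j)) :
  pairing p1 dq1 =
    pairing p0 dq0 - dt * \sum_(i < s) b i * pairing (Diff L (Qs i)) (dQs i).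
Proof.
have symp i j : b i * conjugate_coeff a b i j + b j * a j i = b i * b j.
  by apply: conjugate_coeff_symplectic; rewrite gt_eqF.
rewrite /pairing p1E dq1E.
rewrite (symplectic_pairing_increment _ _ _ _ _ _ _ _ _ _ _ _ _ _ symp PsE dQsE).
congr (_ + _); rewrite -mulrN -sumrN; congr (dt * _); apply: eq_bigr => i _.
rewrite -mulrN; congr (b i * _).
(* [adjoint] is precomposition, so its value at [dQs i] is [Ps i] applied to
   [Diff f (Qs i) (dQs i)], which cancels. *)
by rewrite add_lfunE comp_lfunE opprD addrA subrr add0r.
Qed.
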